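(* Let $X$ be a homogeneously self-similar graph (not assumed locally finite) with constant inner degree. Then one of the following statements is true: (i) The graph $X$ has bounded geometry. (ii) There exists no origin vertex, and $X$ is locally finite but has unbounded geometry. (iii) There exists an origin vertex and $X$ is non-locally finite.
   Context: Graph $X$ with vertex set $VX$ and edge set $EX$ is connected, infinite, without loops or multiple edges; vertices may have infinite degree. $d_X$ is the graph distance and $\deg_X x$ the number of neighbours of $x$ in $X$. $X$ is locally finite if all vertex degrees are finite. For $C\subset VX$, the boundary $\theta C$ is the set of vertices in $VX\setminus C$ adjacent to some vertex of $C$; the closure is $\overline{C}=C\cup\theta C$; $\hat C$ is the subgraph of $X$ spanned (induced) by $\overline{C}$. For $F\subset VX$, $\mathcal{C}_XF$ denotes the set of connected components of $VX\setminus F$ (as vertex sets). The reduced graph $X_F$ has vertex set $F$, and two (distinct) vertices $x,y\in F$ are adjacent in $X_F$ iff there is $C\in\mathcal{C}_XF$ with $x,y\in\theta C$. $X$ is self-similar with respect to $F\subset VX$ and $\psi:VX\to F$ if: (F1) no two vertices of $F$ are adjacent in $X$; (F2) the intersection of the closures of two different components in $\mathcal{C}_XF$ contains at most one vertex; (F3) $\psi$ is a graph isomorphism from $X$ to $X_F$. Elements of $\mathcal{C}_XF$ are called cells. An origin vertex is a fixed point of $\psi$. A self-similar graph $X$ is homogeneously self-similar if: (H1) all cell graphs $\hat C$ ($C\in\mathcal{C}_XF$) are finite and for any cells $C,D$ there is a graph isomorphism $\alpha:\hat C\to\hat D$ with $\alpha(\theta C)=\theta D$; (H2) for every cell $C$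 and $v_1,v_2,v_3,v_4\in\theta C$ with $v_1\neq v_2$, $v_3\ne v_4$, one has $d_X(v_1,v_2)=d_X(v_3,v_4)$. $X$ has bounded geometry if the set of its vertex degrees is bounded (by a finite number), and unbounded geometry otherwise. $X$ has constant inner degree if there is a number $b$ with $b=\deg_{\hat C}v$ for every cell $C$ and every $v\in\theta C$. *)

(* Defs.v *)
From mathcomp Require Import all_boot.
From mathcomp Require Import boolp classical_sets functions cardinality.

Set Implicit Arguments.
Unset Strict Implicit.
Unset Printing Implicit Defensive.

Local Open Scope classical_set_scope.
Local Open Scope card_scope.

(* A simple graph carries its vertex set as a subset of an ambient type, so that
   a graph, its induced subgraphs and its reduced graph share the same type.
   There is no restriction on cardinality. *)
Record graph (T : Type) := Graph {
  vertices : set T;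
  adj : T -> T -> Prop;
  adj_vertex : forall x y, adj x y -> vertices x;
  adj_sym : forall x y, adj x y -> adj y x;
  adj_irrefl : forall x, ~ adj x x
}.

Section Graphs.
Variables (T : Type) (X : graph T).

Definition neighbours (x : T) : set T := [set y | adj X x y].

Fixpoint walk (n : nat) (x y : T) : Prop :=
  if n is m.+1 then exists2 z, adj X x z & walk m z y else x = y.

Definition connected_graph : Prop :=
  forall x y, vertices X x -> vertices X y -> exists n, walk n x y.

(* The length of a shortest walk; a junk value when x and y are not joined by a
   walk, which does not happen in a connected graph. *)
Definition dist (x y : T) : nat :=
  get [set n | walk n x y /\ forall m, walk m x y -> (n <= m)%N].

Definition component (x : T) : set T := [set y | exists n, walk n x y].

Definition components : set (set T) := [set component x | x in vertices X].

Definition vertex_boundary (C : set T) : set T :=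
  [set x | [/\ vertices X x, ~ C x & exists2 y, C y & adj X x y]].

Definition vertex_closure (C : set T) : set T := C `|` vertex_boundary C.

Definition locally_finite : Prop :=
  forall x, vertices X x -> finite_set (neighbours x).

Definition bounded_geometry : Prop :=
  exists N : nat, forall x, vertices X x -> neighbours x #<= `I_N.

End Graphs.

Section Induced.
Variables (T : Type) (X : graph T) (A : set T).

Definition ind_adj (x y : T) : Prop := [/\ A x, A y & adj X x y].

Lemma ind_adj_vertex x y : ind_adj x y -> (vertices X `&` A) x.
Proof. by case=> Ax _ xy; split=> //; exact: adj_vertex xy. Qed.

Lemma ind_adj_sym x y : ind_adj x y -> ind_adj y x.
Proof. by case=> Ax Ay xy; split=> //; exact: adj_sym. Qed.

Lemma ind_adj_irrefl x : ~ ind_adj x x.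
Proof. by case=> _ _; exact: adj_irrefl. Qed.

Definition induced : graph T :=
  Graph ind_adj_vertex ind_adj_sym ind_adj_irrefl.

End Induced.

Definition cells (T : Type) (X : graph T) (F : set T) : set (set T) :=
  components (induced X (vertices X `\` F)).

Definition cell_graph (T : Type) (X : graph T) (C : set T) : graph T :=
  induced X (vertex_closure X C).

Section Reduced.
Variables (T : Type) (X : graph T) (F : set T).

Definition red_adj (x y : T) : Prop :=
  [/\ F x, F y, x <> y
    & exists2 C, cells X F C & vertex_boundary X C x /\ vertex_boundary X C y].

Lemma red_adj_vertex x y : red_adj x y -> F x.
Proof. by case. Qed.

Lemma red_adj_sym x y : red_adj x y -> red_adj y x.
Proof.
by case=> Fx Fy xy [C CC [Cx Cy]]; split=> //; [exact/nesym | exists C].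
Qed.

Lemma red_adj_irrefl x : ~ red_adj x x.
Proof. by case. Qed.

Definition reduced : graph T :=
  Graph red_adj_vertex red_adj_sym red_adj_irrefl.

End Reduced.

(* Only the restriction of f to the vertices of G matters. *)
Definition graph_iso (T : Type) (G H : graph T) (f : T -> T) : Prop :=
  set_bij (vertices G) (vertices H) f /\
  forall x y, vertices G x -> vertices G y ->
    (adj G x y <-> adj H (f x) (f y)).

Section SelfSimilar.
Variables (T : Type) (X : graph T) (F : set T) (psi : T -> T).

Definition self_similar : Prop :=
  [/\ F `<=` vertices X,
      forall x y, F x -> F y -> ~ adj X x y,
      forall C D, cells X F C -> cells X F D -> C <> D ->
        is_subset1 (vertex_closure X C `&` vertex_closure X D)
    & graph_iso X (reduced X F) psi].

Definition homogeneous : Prop :=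
  [/\ forall C, cells X F C -> finite_set (vertices (cell_graph X C)),
      forall C D, cells X F C -> cells X F D ->
        exists2 alpha, graph_iso (cell_graph X C) (cell_graph X D) alpha
                     & alpha @` vertex_boundary X C = vertex_boundary X D
    & forall C v1 v2 v3 v4, cells X F C ->
        vertex_boundary X C v1 -> vertex_boundary X C v2 ->
        vertex_boundary X C v3 -> vertex_boundary X C v4 ->
        v1 <> v2 -> v3 <> v4 -> dist X v1 v2 = dist X v3 v4].

Definition homogeneously_self_similar : Prop := self_similar /\ homogeneous.

(* Cells of a homogeneously self-similar graph have finite closure, so that b
   ranges over the natural numbers. *)
Definition constant_inner_degree : Prop :=
  exists b : nat, forall C v, cells X F C -> vertex_boundary X C v ->
    neighbours (cell_graph X C) v #= `I_b.

Definition origin_vertex (x : T) : Prop := vertices X x /\ psi x = x.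

End SelfSimilar.

(* Main.v *)
(* The map psi at least doubles distances, because a walk of X between vertices
   of F enters and leaves a cell for each step of the reduced graph.  Hence a set
   S contained in psi(S) has at most one point, which is then an origin.  If
   every cell has t + 1 boundary vertices, counting the cells around psi y gives
   deg (psi y) = (b / t) * deg y.  A vertex off F has all its neighbours in the
   closure of one cell, so its degree is bounded uniformly.  Without an origin,
   the set of vertices of infinite degree is therefore empty; with an origin of
   finite degree, b = t, so psi preserves degrees and the vertices of larger
   degree than the origin and those off F form an empty set. *)
Require Import Defs.
From mathcomp Require Import all_boot zify.
From mathcomp Require Import boolp classical_sets functions cardinality.

Set Implicit Arguments.
Unset Strict Implicit.
Unset Printing Implicit Defensive.

Local Open Scope classical_set_scope.
Local Open Scope card_scope.

(** * Cardinalities of disjoint unions *)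

Lemma card_bigcup_II (U : pointedType) (T : Type) (I : set U) (G : U -> set T)
    (n k : nat) :
  trivIset I G -> (forall i, I i -> G i #= `I_k) -> I #= `I_n ->
  \bigcup_(i in I) G i #= `I_(n * k).
Proof.
move=> disjG cardG /card_set_bijP[f [fun_f inj_f surj_f]].
have /choice[g gP] : forall i, exists g : T -> nat, I i -> set_bij (G i) `I_k g.
  move=> i; have [Ii|nIi] := pselect (I i); last by exists (fun=> 0).
  by have /card_set_bijP[g gP] := cardG i Ii; exists g.
(* [idx] recovers the index of the piece containing [x]; [point] is a junk value off the union. *)
have /choice[idx idxP] : forall x : T, exists i,
    (\bigcup_(i in I) G i) x -> I i /\ G i x.
  move=> x; have [[i Ii Gix]|nGx] := pselect ((\bigcup_(i in I) G i) x).
    by exists i.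
  by exists point.
have idxE i x : I i -> G i x -> idx x = i.
  move=> Ii Gix; have [|Ij Gjx] := idxP x; first by exists i.
  by apply: disjG => //; exists x.
(* Mixed-radix numbering: division by [k] gives back the number of the piece as quotient and the
   position inside it as remainder. *)
apply/card_set_bijP; exists (fun x => f (idx x) * k + g (idx x) x); split.
- move=> x [i Ii Gix] /=; rewrite (idxE i)//.
  have [/(_ _ Gix)/= gk _ _] := gP i Ii; have /= fn := fun_f i Ii.
  apply: (@leq_trans ((f i).+1 * k)); last by rewrite leq_mul2r fn orbT.
  by rewrite mulSn addnC ltn_add2r.
- move=> x y /set_mem[i Ii Gix] /set_mem[j Ij Gjy].
  rewrite (idxE i)// (idxE j)//.
  have [/(_ _ Gix)/= gik inj_g _] := gP i Ii.
  have [/(_ _ Gjy)/= gjk _ _] := gP j Ij.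
  have k_gt0 : 0 < k by exact: leq_trans gik.
  move=> e; have fij : f i = f j.
    have := congr1 (divn^~ k) e.
    by rewrite !divnMDl// !divn_small// !addn0.
  have ij : i = j by apply: inj_f; rewrite ?inE.
  rewrite -{}ij in Gjy gjk e *; move/addnI: e => e.
  by apply: inj_g; rewrite ?inE.
- move=> p /= pnk; have k_gt0 : 0 < k.
    by case: k pnk {cardG gP} => //; rewrite muln0.
  have [i Ii fi] : (f @` I) (p %/ k) by apply: surj_f => /=; rewrite ltn_divLR.
  have [_ _ /(_ (p %% k))[]] := gP i Ii; first by rewrite /= ltn_mod.
  move=> x Gix gx; exists x; first by exists i.
  by rewrite (idxE i)// fi gx -divn_eq.
Qed.

Lemma card_setD1_II (T : Type) (A : set T) (x : T) (n : nat) :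
  A x -> A #= `I_n -> A `\ x #= `I_n.-1.
Proof.
move=> Ax /card_set_bijP[f [fun_f inj_f surj_f]].
have fxn : f x < n by exact: fun_f.
have neq y : A y -> y <> x -> f y \in predC1 (f x).
  by move=> Ay yx; apply/eqP => /inj_f e; apply: yx; apply: e; rewrite inE.
(* [unbump (f x)] closes the gap that the removal of [x] leaves in the numbering. *)
apply/card_set_bijP; exists (unbump (f x) \o f); split.
- move=> y [Ay /(neq y Ay)]; have /= := fun_f y Ay.
  by rewrite inE /= /unbump; case: ltngtP => //=; lia.
- move=> y z /set_mem[Ay /(neq y Ay)/unbumpK ey] /set_mem[Az /(neq z Az)/unbumpK ez].
  move=> /= e; apply: inj_f; rewrite ?inE//.
  by rewrite -ey -ez e.
- move=> p /= pn.
  have [y Ay fy] : (f @` A) (bump (f x) p).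
    by apply: surj_f; rewrite /= /bump; case: leqP => /=; lia.
  exists y; last by rewrite /= fy bumpK.
  split=> // yx; move: fy; rewrite yx => /eqP; apply/negP; exact: neq_bump.
Qed.

(** Any point of a nonempty piece determines its index, so [I] lies in the image of the finite
    union. *)
Lemma finite_index_bigcup (U : pointedType) (T : Type) (I : set U)
    (G : U -> set T) :
  trivIset I G -> (forall i, I i -> G i !=set0) ->
  finite_set (\bigcup_(i in I) G i) -> finite_set I.
Proof.
move=> disjG G0 finG.
have /choice[idx idxP] : forall x : T, exists i,
    (\bigcup_(i in I) G i) x -> I i /\ G i x.
  move=> x; have [[i Ii Gix]|nGx] := pselect ((\bigcup_(i in I) G i) x).
    by exists i.
  by exists point.
apply: sub_finite_set (finite_image idx finG) => i Ii.
have [x Gix] := G0 i Ii; have Gx : (\bigcup_(i in I) G i) x by exists i.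
exists x => //; have [Ij Gjx] := idxP x Gx.
by apply: disjG => //; exists x.
Qed.

(** * Walks and components *)

Section Walks.
Variables (T : Type) (X : graph T).

Lemma walk_trans m n x y z : walk X m x y -> walk X n y z -> walk X (m + n) x z.
Proof.
elim: m x => [x -> //|m IH x [w xw wy] yz].
by exists w => //; exact: IH.
Qed.

Lemma walk_sym n x y : walk X n x y -> walk X n y x.
Proof.
elim: n x => [//|n IH x [z xz /IH yz]]; rewrite -addn1.
by apply: walk_trans yz _; exists x => //; exact: adj_sym.
Qed.

Lemma eq_component x y : component X x y -> component X x = component X y.
Proof.
move=> [m xy]; apply/seteqP; split=> z [n wz].
  by exists (m + n); exact: walk_trans (walk_sym xy) wz.
by exists (m + n); exact: walk_trans xy wz.
Qed.

Lemma component_vertex x y : vertices X x -> component X x y -> vertices X y.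
Proof.
move=> Xx [n]; elim: n x Xx => [x Xx <- //|n IH x _ [z xz]].
by apply: IH; exact: adj_vertex (adj_sym xz).
Qed.

End Walks.

(** * Cells, their boundaries and the reduced graph *)

Section Cells.
Variables (T : Type) (X : graph T) (F : set T).

Let cell (x : T) : set T := component (induced X (vertices X `\` F)) x.

Lemma cellP x : vertices X x -> ~ F x -> cells X F (cell x).
Proof. by move=> Xx nFx; exists x. Qed.

Lemma mem_cell x : cell x x.
Proof. by exists 0. Qed.

Lemma cell_vertex C x : cells X F C -> C x -> vertices X x /\ ~ F x.
Proof. by move=> [y yV <-] /(component_vertex yV)[_]. Qed.

Lemma cell_eq C x : cells X F C -> C x -> C = cell x.
Proof. by move=> [y yV <-]; exact: eq_component. Qed.

Lemma cell_adj x y : vertices X x -> ~ F x -> ~ F y -> adj X x y ->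
  cell x = cell y.
Proof.
move=> Xx nFx nFy xy; apply: eq_component; exists 1, y => //.
by split=> //; split=> //; exact: adj_vertex (adj_sym xy).
Qed.

(** A vertex off [F] that is adjacent to a cell belongs to that cell. *)
Lemma boundary_sub C x : cells X F C -> vertex_boundary X C x -> F x.
Proof.
move=> CC [Xx nCx [y Cy xy]]; apply: contrapT => nFx; apply: nCx.
have [_ nFy] := cell_vertex CC Cy.
by rewrite (cell_eq CC Cy) -(cell_adj Xx nFx nFy xy); exact: mem_cell.
Qed.

Lemma cell_boundary x y : F x -> ~ F y -> adj X x y ->
  vertex_boundary X (cell y) x.
Proof.
move=> Fx nFy xy; have Xx := adj_vertex xy; split=> //; last first.
  by exists y => //; exact: mem_cell.
have Xy := adj_vertex (adj_sym xy).
  by move=> /(cell_vertex (cellP Xy nFy))[].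
Qed.

Lemma neighbours_closure C x : cells X F C -> C x ->
  neighbours X x `<=` vertices (cell_graph X C).
Proof.
move=> CC Cx y xy; have Xy := adj_vertex (adj_sym xy).
have [Xx nFx] := cell_vertex CC Cx.
split=> //; have [Fy|nFy] := pselect (F y).
  right; rewrite (cell_eq CC Cx).
  by apply: cell_boundary => //; exact: adj_sym.
by left; rewrite (cell_eq CC Cx) (cell_adj Xx nFx nFy xy); exact: mem_cell.
Qed.

Definition cells_at (v : T) : set (set T) :=
  [set C | cells X F C /\ vertex_boundary X C v].

Hypothesis F_indep : forall x y, F x -> F y -> ~ adj X x y.

Lemma neighbours_cells v : F v ->
  neighbours X v = \bigcup_(C in cells_at v) neighbours (cell_graph X C) v.
Proof.
move=> Fv; apply/seteqP; split=> [w vw|w [C _ [_ _]] //].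
have nFw : ~ F w by move=> Fw; exact: F_indep vw.
have Xw := adj_vertex (adj_sym vw); have bv := cell_boundary Fv nFw vw.
exists (cell w); first by split=> //; exact: cellP.
by split=> //; [right | left; exact: mem_cell].
Qed.

(** A common neighbour of [v] is off [F] by independence, hence lies in both components themselves
    and not merely in their closures. *)
Lemma disjoint_neighbours_cells v : F v ->
  trivIset (cells_at v) (fun C => neighbours (cell_graph X C) v).
Proof.
move=> Fv C D [CC _] [DC _] [w [[_ Cw vw] [_ Dw _]]].
have nFw : ~ F w by move=> Fw; exact: F_indep vw.
have mem E : cells X F E -> vertex_closure X E w -> E w.
  by move=> EC [//|/(boundary_sub EC)].
by rewrite (cell_eq CC (mem _ CC Cw)) (cell_eq DC (mem _ DC Dw)).
Qed.

(** Counterpart of [neighbours_cells] over the same index set, which lets the degrees in [X] and in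
    the reduced graph be compared cell by cell. *)
Lemma neighbours_reduced v :
  neighbours (reduced X F) v
  = \bigcup_(C in cells_at v) (vertex_boundary X C `\ v).
Proof.
apply/seteqP; split=> [w [Fv Fw vw [C CC [Cv Cw]]]|w [C [CC Cv] [Cw wv]]].
  by exists C => //; split=> // /esym.
split; [exact: boundary_sub Cv|exact: boundary_sub Cw|exact/nesym|].
by exists C.
Qed.

(* A walk between vertices of F alternates between F and the cells, so that it
   uses at least two steps of X for each step of the reduced graph. *)
Lemma walk_reduced n x y : F x -> F y -> walk X n x y ->
  exists2 m, m.*2 <= n & walk (reduced X F) m x y.
Proof.
(* The induction also needs walks starting inside a cell: [v] is where such a walk first leaves the
   cell. The strict inequality keeps one step in reserve, which pays for entering the cell. *)
move=> Fx Fy; suff : (F x -> walk X n x y ->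
    exists2 m, m.*2 <= n & walk (reduced X F) m x y) /\
  (~ F x -> walk X n x y -> exists v m, [/\ vertex_boundary X (cell x) v,
     m.*2 < n & walk (reduced X F) m v y]) by case=> + _; exact.
elim: n x {Fx} => [|n IH] x; split=> [Fx /=|nFx].
- by move=> <-; exists 0.
- by move=> e; rewrite e in nFx.
- move=> [z xz zy]; have nFz : ~ F z by move=> Fz; exact: F_indep xz.
  have [_ /(_ nFz zy)[v [m [zv mn vy]]]] := IH z.
  (* A walk that leaves the cell where it entered makes no step in the reduced graph. *)
  have [->|xv] := pselect (x = v); first by exists m => //; exact: leqW (ltnW mn).
  exists m.+1; first by rewrite doubleS ltnS.
  have Xz := adj_vertex (adj_sym xz).
  exists v => //; split=> //; first exact: boundary_sub (cellP Xz nFz) zv.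
  by exists (cell z); [exact: cellP | split=> //; exact: cell_boundary].
- move=> [z xz zy]; have [Fz|nFz] := pselect (F z).
    have [/(_ Fz zy)[m mn zy'] _] := IH z.
    exists z, m; split=> //; apply: cell_boundary => //; exact: adj_sym.
  have [_ /(_ nFz zy)[v [m [zv mn vy]]]] := IH z.
  exists v, m; split=> //; last exact: leqW.
  by rewrite (cell_adj (adj_vertex xz) nFx nFz xz).
Qed.

End Cells.

(** * Expansion of distances by [psi] *)

Section SelfSimilar.
Variables (T : Type) (X : graph T) (F : set T) (psi : T -> T).
Hypothesis X_conn : connected_graph X.
Hypothesis X_ss : self_similar X F psi.

(** By (F2), the closures of two distinct cells around [v] meet only in [v]. *)
Lemma disjoint_boundary v :
  trivIset (cells_at X F v) (fun C => vertex_boundary X C `\ v).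
Proof.
have [_ _ F2 _] := X_ss.
move=> C D [CC Cv] [DC Dv] [w [[Cw wv] [Dw _]]]; apply: contrapT => CD.
by apply: wv; apply: (F2 C D) => //; split; right.
Qed.

Lemma psi_F x : vertices X x -> F (psi x).
Proof. by have [_ _ _ [[+ _ _] _]] := X_ss; exact. Qed.

Lemma psi_inj : set_inj (vertices X) psi.
Proof. by have [_ _ _ [[]]] := X_ss. Qed.

Lemma psi_surj x : F x -> exists2 y, vertices X y & psi y = x.
Proof. by have [_ _ _ [[_ _ +] _]] := X_ss; exact. Qed.

Lemma neighbours_psi x : vertices X x ->
  neighbours (reduced X F) (psi x) = psi @` neighbours X x.
Proof.
move=> Xx; have [_ _ _ [_ psi_adj]] := X_ss; apply/seteqP; split=> [w xw|].
  have [y Xy yw] := psi_surj (adj_vertex (adj_sym xw)).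
  by exists y => //; apply/psi_adj => //; rewrite yw.
move=> _ [y xy <-]; apply/psi_adj => //; exact: adj_vertex (adj_sym xy).
Qed.

Lemma walk_psi n x y : vertices X x -> vertices X y ->
  walk (reduced X F) n (psi x) (psi y) -> walk X n x y.
Proof.
move=> Xx Xy; elim: n x Xx => [|n IH] x Xx /=.
  by move=> e; apply: psi_inj; rewrite ?inE.
move=> [w xw wy]; have : neighbours (reduced X F) (psi x) w by [].
rewrite neighbours_psi// => -[z xz zw]; rewrite -zw in wy.
by exists z => //; apply: IH wy; exact: adj_vertex (adj_sym xz).
Qed.

(* psi at least doubles distances, so infinitely many steps backwards along psi
   would bring two points of S to distance 0. *)
Lemma sub_image_psi_subset1 (S : set T) :
  S `<=` vertices X -> S `<=` psi @` S -> is_subset1 S.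
Proof.
move=> SX Spsi x y Sx Sy; have [_ F_indep _ _] := X_ss.
have [n] := X_conn (SX x Sx) (SX y Sy).
elim/ltn_ind: n x y Sx Sy => -[//|n] IH _ _ /Spsi[x Sx <-] /Spsi[y Sy <-].
have [Xx Xy] := (SX x Sx, SX y Sy).
move=> /(walk_reduced F_indep (psi_F Xx) (psi_F Xy))[m mn /(walk_psi Xx Xy) xy].
congr psi; apply: IH xy => //.
by case: m mn => // m mn; rewrite (leq_trans _ mn)// doubleS !ltnS -addnn leq_addr.
Qed.

Lemma sub_image_psi_origin (S : set T) x :
  S `<=` vertices X -> S `<=` psi @` S -> S x -> origin_vertex X psi x.
Proof.
move=> SX Spsi Sx; split; first exact: SX.
have [FX _ _ _] := X_ss.
apply: (@sub_image_psi_subset1 (psi @` S)).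
- by move=> _ [y Sy <-]; apply: FX; apply: psi_F; exact: SX.
- exact: image_subset.
- by exists x.
- exact: Spsi.
Qed.

End SelfSimilar.

(** * Degrees under [psi], and the role of origins *)

Section Degrees.
Variables (T : Type) (X : graph T) (F : set T) (psi : T -> T) (b : nat).
Hypothesis X_conn : connected_graph X.
Hypothesis X_infinite : infinite_set (vertices X).
Hypothesis X_hss : homogeneously_self_similar X F psi.
Hypothesis X_cid : forall C v, cells X F C -> vertex_boundary X C v ->
  neighbours (cell_graph X C) v #= `I_b.

Lemma neighbours_neq0 x : vertices X x -> neighbours X x !=set0.
Proof.
move=> Xx; have [y [Xy yx]] : (vertices X `\ x) !=set0.
  apply: infinite_setN0 => fin; apply: X_infinite.
  have : finite_set ([set x] `|` vertices X `\ x) by rewrite finite_setU.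
  apply: sub_finite_set => y Xy.
  by have [->|yx] := pselect (y = x); [left | right].
have [[|n] /=] := X_conn Xx Xy; first by move=> e; case: yx.
by case=> z xz _; exists z.
Qed.

Lemma neighbours_off_F_bounded :
  exists M, forall x, vertices X x -> ~ F x -> neighbours X x #<= `I_M.
Proof.
have [_ [fin iso _]] := X_hss.
have [[C CC]|noC] := pselect (exists C, cells X F C); last first.
  by exists 0 => x Xx nFx; case: noC; eexists; exact: cellP Xx nFx.
(* The size of one closure serves for all cells, since (H1) makes their closures equinumerous. *)
have [M CM] := fin C CC; exists M => x Xx nFx.
have DC := cellP Xx nFx; set D := component _ x in DC.
have [alpha [[afun ainj asurj] _] _] := iso D C DC CC.
apply: card_le_trans (subset_card_le (neighbours_closure DC _)) _.
  exact: mem_cell.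
rewrite -(card_le_eqr CM) -(card_le_eql (inj_card_eq ainj)).
by apply: subset_card_le => _ [y Dy <-]; exact: afun.
Qed.

(** The isomorphisms of (H1) match boundaries, so all have the same size. An edge of [X] becomes an
    edge of the reduced graph, which exhibits a cell with two boundary vertices; hence [t] is
    positive. *)
Lemma boundary_card : exists2 t, 0 < t &
  forall C v, cells X F C -> vertex_boundary X C v ->
    vertex_boundary X C `\ v #= `I_t.
Proof.
have [X_ss [fin iso _]] := X_hss.
have [x Xx] := infinite_setN0 X_infinite.
have [y xy] := neighbours_neq0 Xx.
have : neighbours (reduced X F) (psi x) (psi y).
  by rewrite (neighbours_psi X_ss)//; exists y.
rewrite neighbours_reduced => -[C [CC Cx] [Cy yx]].
have sub D : cells X F D -> vertex_boundary X D `<=` vertices (cell_graph X D).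
  by move=> DC v Dv; split; [case: Dv | right].
have [n Cn] := sub_finite_set (sub C CC) (fin C CC).
exists n.-1; last first.
  move=> D v DC Dv; apply: card_setD1_II => //.
  have [alpha [[_ ainj _] _] aC] := iso D C DC CC.
  rewrite -(card_eqr Cn) -aC card_eq_sym; apply: inj_card_eq.
  by apply: sub_in2 ainj => z; rewrite !inE; exact: sub.
have := card_setD1_II Cx Cn; case: n.-1 => // /card_esym.
rewrite II0 card_eq_sym card_eq0 => /eqP e.
by have : (vertex_boundary X C `\ psi x) (psi y) by []; rewrite e.
Qed.

(* If v = psi y lies on n cell boundaries, then it has n * b neighbours in X,
   and n * t neighbours in the reduced graph, as many as y has in X. *)
Lemma degree_psi : exists2 t, 0 < t &
  forall y, vertices X y -> finite_set (neighbours X y) ->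
    exists n, neighbours X y #= `I_(n * t) /\
              neighbours X (psi y) #= `I_(n * b).
Proof.
have [t t_gt0 bt] := boundary_card; exists t => // y Xy fin_y.
have [X_ss _] := X_hss; have [_ F_indep _ _] := X_ss.
have Fy := psi_F X_ss Xy.
have psiE := neighbours_psi X_ss Xy; rewrite neighbours_reduced in psiE.
have disjB := disjoint_boundary X_ss (v := psi y).
(* As [t] is positive, each cell at [psi y] contributes a nonempty piece to its finite reduced
   neighbourhood, and the pieces are disjoint. *)
have [n cn] : finite_set (cells_at X F (psi y)).
  apply: finite_index_bigcup disjB _ _; last first.
    by rewrite psiE; exact: finite_image.
  move=> C [CC Cv]; apply/set0P/eqP => e.
  have := bt C _ CC Cv; rewrite e => /card_esym; rewrite card_eq0 => /eqP e'.
  by have : `I_t 0 by []; rewrite e'.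
exists n; split; last first.
  rewrite (neighbours_cells F_indep Fy); apply: card_bigcup_II cn.
    exact: disjoint_neighbours_cells.
  by move=> C [CC Cv]; exact: X_cid.
have psi_inj' : {in neighbours X y &, injective psi}.
  apply: sub_in2 (psi_inj X_ss) => z; rewrite !inE => yz.
  exact: adj_vertex (adj_sym yz).
rewrite -(card_eql (inj_card_eq psi_inj')) -psiE.
by apply: card_bigcup_II cn => // C [CC Cv]; exact: bt.
Qed.

Lemma no_origin_locally_finite :
  ~ (exists x, origin_vertex X psi x) -> locally_finite X.
Proof.
move=> no_origin; have [X_ss _] := X_hss.
have [t _ deg] := degree_psi; have [M offF] := neighbours_off_F_bounded.
move=> x Xx; apply: contrapT => infx; apply: no_origin; exists x.
(* A vertex of infinite degree is in [F], and its preimage has infinite degree because [psi] keeps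
   finite degrees finite. So [S] lies in its image. *)
pose S := [set z | vertices X z /\ ~ finite_set (neighbours X z)].
apply: (sub_image_psi_origin X_conn X_ss (S := S)) => //; first by move=> z [].
move=> z [Xz infz]; have [Fz|nFz] := pselect (F z); last first.
  by case: infz; exact: card_le_finite (offF z Xz nFz) _.
have [y Xy yz] := psi_surj X_ss Fz; exists y => //; split=> // finy.
by have [n [_ e]] := deg y Xy finy; apply: infz; rewrite -yz; exists (n * b).
Qed.

Lemma origin_bounded_geometry o :
  origin_vertex X psi o -> locally_finite X -> bounded_geometry X.
Proof.
move=> [Xo oE] lfX; have [X_ss _] := X_hss.
have [t t_gt0 deg] := degree_psi; have [M offF] := neighbours_off_F_bounded.
have [n [no]] := deg o Xo (lfX o Xo); rewrite oE => no'.
have n_gt0 : 0 < n.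
  rewrite lt0n; apply/eqP => n0; have [z] := neighbours_neq0 Xo.
  by move: no; rewrite n0 mul0n II0 card_eq0 => /eqP ->.
(* Both products count the neighbours of [o], which is its own image. *)
have bt : t = b.
  have /card_eq_II/eqP : `I_(n * t) #= `I_(n * b).
    by rewrite -(card_eql no).
  by rewrite eqn_pmul2l// => /eqP.
exists (maxn M (n * t)); apply: contrapT => unb.
have [x [Xx xbig]] : exists x, vertices X x /\
    ~ (neighbours X x #<= `I_(maxn M (n * t))).
  apply: contrapT => none; apply: unb => x Xx; apply: contrapT => xbig.
  by apply: none; exists x.
pose S := [set z | vertices X z /\
  ~ (neighbours X z #<= `I_(maxn M (n * t)))].
(* Adding the fixed point [o] to [S] preserves the inclusion in the image, and a set with at most
   one point then forces [x] to be [o], whose degree is within the bound. *)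
have xo : x = o.
  apply: (sub_image_psi_subset1 X_conn X_ss (S := S `|` [set o])).
  - by move=> z [[]//|->].
  - move=> z [[Xz zbig]|->]; last by exists o => //; right.
    have [Fz|nFz] := pselect (F z); last first.
      case: zbig; apply: card_le_trans (offF z Xz nFz) _.
      by rewrite card_le_II leq_maxl.
    have [y Xy yz] := psi_surj X_ss Fz; exists y => //; left; split=> //.
    have [m [ym]] := deg y Xy (lfX y Xy); rewrite -bt yz => zm.
    by rewrite (card_le_eql ym) -(card_le_eql zm).
  - by left.
  - by right.
by apply: xbig; rewrite xo (card_le_eql no) card_le_II leq_maxr.
Qed.

End Degrees.

Theorem corollary1 (T : Type) (X : graph T) (F : set T) (psi : T -> T)
    (X_connected : connected_graph X)
    (X_infinite : infinite_set (vertices X))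
    (X_hss : homogeneously_self_similar X F psi)
    (X_cid : constant_inner_degree X F) :
  [\/ bounded_geometry X,
      [/\ ~ (exists x, origin_vertex X psi x), locally_finite X
        & ~ bounded_geometry X]
    | (exists x, origin_vertex X psi x) /\ ~ locally_finite X].
Proof.
have [b X_cid'] := X_cid.
have [bX|ubX] := pselect (bounded_geometry X); first by apply: Or31.
have [[o oX]|no] := pselect (exists x, origin_vertex X psi x).
  apply: Or33; split; first by exists o.
  by move=> /(origin_bounded_geometry X_connected X_infinite X_hss X_cid' oX).
apply: Or32; split=> //.
exact: no_origin_locally_finite X_connected X_infinite X_hss X_cid' no.
Qed.
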